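(* Let $n,r$ be nonnegative integers with $2\leq r\leq\lceil n/2\rceil$. Then it is possible for the pulse $K(n,r)$ to terminate in $\mathrm{Az}(n)$: there is a finite sequence of firing moves from $K(n,r)$ ending at the stable configuration $\mathrm{Az}(n)$.
   Context: The grid complex is the tiling of the plane by unit squares (''faces''); two faces are adjacent if they share an edge, and $\mathrm{dist}(f,g)$ is the Manhattan distance between faces. A configuration $K$ assigns an integer weight $K_f$ to each face $f$, with finitely many nonzero weights; there is a marked face $f_0$ with $K_{f_0}=n$. Firing moves: (i) if $f,g$ are adjacent faces, both different from $f_0$, with $K_f\geq K_g+2$, one may fire $f$ towards $g$, decreasing $K_f$ by $1$ and increasing $K_g$ by $1$; (ii) if $g$ is adjacent to $f_0$ and $K_g<n$, one may fire from $f_0$ to $g$, increasing $K_g$ by $1$; (iii) if $g$ is adjacent to $f_0$ and $K_g>n$, one may fire from $g$ to $f_0$, decreasing $K_g$ by $1$; the weight of $f_0$ never changes. A configuration is stable if no firing move is possible. The pulse $K(n,r)$ has $K(n,r)_f=n$ if $\mathrm{dist}(f_0,f)\leq r$ and $0$ otherwise. The Aztec diamond $\mathrm{Az}(n)$ has $\mathrm{Az}(n)_{f_0}=n$ and $\mathrm{Az}(n)_f=\max\{n-\mathrm{dist}(f_0,f)+1,0\}$ for $f\neq f_0$. *)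

(* Defs.v *)
From Stdlib Require Export Relation_Operators.
From mathcomp Require Export all_boot all_order all_algebra finmap.
From mathcomp Require Import zify.

Set Implicit Arguments.
Unset Strict Implicit.
Unset Printing Implicit Defensive.

Import Order.TTheory GRing.Theory Num.Theory.
Local Open Scope ring_scope.

(* The face (a, b) is the unit square [a, a + 1] x [b, b + 1]. *)
Definition face : Type := (int * int)%type.

(* An edge is given by its lower-left endpoint and whether it is vertical. *)
Definition edges (f : face) : seq (int * int * bool) :=
  [:: (f.1, f.2, false); (f.1, f.2 + 1, false);
      (f.1, f.2, true); (f.1 + 1, f.2, true)].

Definition adjacent (f g : face) : bool :=
  (f != g) && has (mem (edges f)) (edges g).

Definition dist (f g : face) : nat := (`|f.1 - g.1| + `|f.2 - g.2|)%N.

Definition config : Type := {fsfun face -> int with 0}.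

(* The number n of the firing rules is the weight K f0 of the marked face. *)
Inductive fire (f0 : face) (K : config) : config -> Prop :=
| fire_unmarked (f g : face) :
    adjacent f g -> f != f0 -> g != f0 -> K f >= K g + 2 ->
    fire f0 K [fsfun K with f |-> K f - 1, g |-> K g + 1]
| fire_from_marked (g : face) :
    adjacent f0 g -> K g < K f0 ->
    fire f0 K [fsfun K with g |-> K g + 1]
| fire_to_marked (g : face) :
    adjacent f0 g -> K g > K f0 ->
    fire f0 K [fsfun K with g |-> K g - 1].

Definition stable (f0 : face) (K : config) : Prop :=
  forall L : config, ~ fire f0 K L.

Definition can_terminate_in (f0 : face) (K L : config) : Prop :=
  clos_refl_trans_1n config (fire f0) K L /\ stable f0 L.

(* A square box that contains every face at distance at most r of f0. *)
Definition box (f0 : face) (r : nat) : {fset face} :=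
  seq_fset tt [seq (f0.1 + i%:Z - r%:Z, f0.2 + j%:Z - r%:Z)
              | i <- iota 0 r.*2.+1, j <- iota 0 r.*2.+1].

Lemma mem_box (f0 f : face) (r : nat) : (dist f0 f <= r)%N -> f \in box f0 r.
Proof.
case: f0 f => [a b] [c d]; rewrite /dist /= => le_r.
rewrite seq_fsetE; apply/allpairsP.
exists (`|(c - a + r%:Z)%R|%N, `|(d - b + r%:Z)%R|%N).
by split; [rewrite mem_iota /=; lia | rewrite mem_iota /=; lia |
           congr (_, _) => /=; lia].
Qed.

Definition pulse (f0 : face) (n r : nat) : config :=
  [fsfun f in box f0 r => if (dist f0 f <= r)%N then n%:Z else 0].

Definition aztec (f0 : face) (n : nat) : config :=
  [fsfun f in box f0 n =>
     if f == f0 then n%:Z else Num.max (n%:Z - (dist f0 f)%:Z + 1) 0].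

(* The boxes cut nothing off. *)
Lemma pulseE (f0 f : face) (n r : nat) :
  pulse f0 n r f = if (dist f0 f <= r)%N then n%:Z else 0.
Proof.
rewrite fsfun_fun; case: ifP => // /negbT out.
by case: ifP => // le_r; rewrite mem_box in out.
Qed.

Lemma aztecE (f0 f : face) (n : nat) :
  aztec f0 n f =
    if f == f0 then n%:Z else Num.max (n%:Z - (dist f0 f)%:Z + 1) 0.
Proof.
rewrite fsfun_fun; case: ifP => // /negbT out.
have /negbTE lt_n : ~~ (dist f0 f <= n)%N by apply: contra out; exact: mem_box.
case: eqP => [eq_f|_]; last by lia.
by move: lt_n; rewrite eq_f /dist; lia.
Qed.

(* Main.v *)
(* Cut the faces other than [f0] into rays going away from [f0]: the half-rows
   starting next to the column of [f0], and the two halves of that column. Along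
   a ray, a stretch of weights [n], ..., [n], 0, 0, ... has to spread into a part
   of [n], [n] - 1, ..., 1, 0, ... . Fire outwards along rays as long as possible.
   By the least action principle no edge is fired more often than the amount of
   weight that the Aztec diamond has beyond it in excess of the pulse; this
   amount is nonnegative exactly because [r] is at most [n / 2] rounded up. So
   the weights stay within distance [n], and once no ray can fire, slopes of at
   most 1 force the configuration below the Aztec diamond. From there, a face
   closest to [f0] among those still in deficit can always be fed by a neighbour
   closer to [f0], without exceeding the Aztec diamond. Every firing used
   increases the moment (the sum of weight times distance to [f0]), which stays
   bounded. *)
Require Import Defs.
From mathcomp Require Import zify.

Set Implicit Arguments.
Unset Strict Implicit.
Unset Printing Implicit Defensive.

Import Order.TTheory GRing.Theory Num.Theory.
Local Open Scope ring_scope.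

(** * Faces, distances and outward rays *)

Lemma adjacentE (f g : face) : adjacent f g = (dist f g == 1%N).
Proof.
case: f g => [a b] [c d]; rewrite /adjacent /dist /edges /=.
by rewrite !inE !xpair_eqE /=; lia.
Qed.

Lemma distxx (f : face) : dist f f = 0%N.
Proof. by rewrite /dist !subrr. Qed.

Lemma dist_gt0 (f0 f : face) : (0 < dist f0 f)%N = (f != f0).
Proof. by case: f0 f => [a b] [c d]; rewrite /dist xpair_eqE /=; lia. Qed.

Lemma adjacent_dist (f0 f g : face) : adjacent f g ->
  (dist f0 g <= (dist f0 f).+1)%N && (dist f0 f <= (dist f0 g).+1)%N.
Proof.
by rewrite adjacentE; case: f0 f g => [a b] [c d] [e h]; rewrite /dist /=; lia.
Qed.

Lemma closer_neighbour (f0 f : face) : f != f0 ->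
  exists2 g, adjacent g f & dist f0 f = (dist f0 g).+1.
Proof.
case: f0 f => [a b] [c d]; rewrite xpair_eqE => ne.
have [lt_ac|] := ltP a c.
  by exists (c - 1, d); rewrite ?adjacentE /dist /=; lia.
have [lt_ca _|] := ltP c a.
  by exists (c + 1, d); rewrite ?adjacentE /dist /=; lia.
have [lt_bd _ _|] := ltP b d.
  by exists (c, d - 1); rewrite ?adjacentE /dist /=; lia.
by exists (c, d + 1); rewrite ?adjacentE /dist /=; lia.
Qed.

(** [f0] is its own successor, so flow along rays never changes its weight. *)
Definition outward (f0 f : face) : face :=
  if f0.1 < f.1 then (f.1 + 1, f.2)
  else if f.1 < f0.1 then (f.1 - 1, f.2)
  else if f0.2 < f.2 then (f.1, f.2 + 1)
  else if f.2 < f0.2 then (f.1, f.2 - 1)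
  else f.

Lemma outward_id (f0 : face) : outward f0 f0 = f0.
Proof. by rewrite /outward !ltxx. Qed.

Lemma dist_outward (f0 f : face) : f != f0 ->
  dist f0 (outward f0 f) = (dist f0 f).+1.
Proof.
case: f0 f => [a b] [c d]; rewrite xpair_eqE /outward /dist /= => ne.
by do ?case: ltP => ? /=; lia.
Qed.

Lemma adjacent_outward (f0 f : face) : f != f0 -> adjacent f (outward f0 f).
Proof.
case: f0 f => [a b] [c d]; rewrite xpair_eqE adjacentE /outward /dist /= => ne.
by do ?case: ltP => ? /=; lia.
Qed.

Lemma outward_neq (f0 f : face) : f != f0 -> outward f0 f != f0.
Proof. by move=> ne; rewrite -dist_gt0 dist_outward. Qed.

(** Rays are disjoint, so extra flow into a face drains only its predecessor on the ray. *)
Lemma outward_inj (f0 : face) : injective (outward f0).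
Proof.
case: f0 => [a b] [c d] [e h] /eqP.
rewrite /outward /= => eq_out; apply/eqP; move: eq_out.
by rewrite xpair_eqE; do ?case: ltP => ? /=; rewrite xpair_eqE; lia.
Qed.

(** * Bounded measures and the moment *)

Lemma clos_rt1n_append (T : Type) (R : T -> T -> Prop) (x y z : T) :
  clos_refl_trans_1n T R x y -> clos_refl_trans_1n T R y z ->
  clos_refl_trans_1n T R x z.
Proof. by elim=> // u v w Ruv _ IH /IH; apply: rt1n_trans. Qed.

(** An integer measure bounded by [B] can increase only finitely often. *)
Lemma progress_reaches (T : Type) (R : T -> T -> Prop) (P Q : T -> Prop)
    (m : T -> int) (B : int) :
    (forall x, P x -> m x <= B) ->
    (forall x, P x -> Q x \/ exists2 y, R x y & P y /\ m x < m y) ->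
  forall x, P x -> exists2 y, clos_refl_trans_1n T R x y & Q y.
Proof.
move=> le_mB step x.
have [k le_k] := ubnP `|B - m x|%N.
elim: k => // k IHk in x le_k * => Px.
have [Qx|[y Rxy [Py lt_xy]]] := step x Px.
  by exists x => //; exact: rt1n_refl.
have [||z y_z Qz] := IHk y => //; first by have := le_mB y Py; lia.
by exists z => //; apply: rt1n_trans y_z.
Qed.

Definition moment (A : {fset face}) (f0 : face) (K : config) : int :=
  \sum_(f <- A) K f * (dist f0 f)%:Z.

Lemma moment_with (A : {fset face}) (f0 : face) (K : config) (g : face)
    (x : int) : g \in A ->
  moment A f0 [fsfun K with g |-> x]
    = moment A f0 K + (x - K g) * (dist f0 g)%:Z.
Proof.
move=> g_in; rewrite /moment !(big_fsetD1 g g_in) /= fsfun_with.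
rewrite (addrAC (K g * _)) -mulrDl subrKC; congr (_ + _).
rewrite big_seq [RHS]big_seq; apply: eq_bigr => f.
by rewrite fsfun_withE in_fsetD1; case: eqP.
Qed.

Lemma moment_le (A : {fset face}) (f0 : face) (n : int) (K : config) :
  (forall f, K f <= n) ->
  moment A f0 K <= \sum_(f <- A) n * (dist f0 f)%:Z.
Proof. by move=> leK; apply: ler_sum => f _; apply: ler_wpM2r. Qed.

Lemma moment_fire (A : {fset face}) (f0 : face) (K : config) (f g : face) :
  f != g -> f \in A -> g \in A -> dist f0 g = (dist f0 f).+1 ->
  moment A f0 [fsfun K with f |-> K f - 1, g |-> K g + 1] = moment A f0 K + 1.
Proof.
move=> ne f_in g_in eq_g; rewrite !moment_with // ?fsfun_withE.
by rewrite (negbTE ne) eq_g; lia.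
Qed.

Lemma fired_weight (K : config) (f g h : face) : f != g ->
  [fsfun K with f |-> K f - 1, g |-> K g + 1] h
    = K h + (h == g)%:Z - (h == f)%:Z.
Proof.
move=> ne; rewrite !fsfun_withE.
case: (eqVneq h f) => [->|_]; first by rewrite (negbTE ne) addr0.
by case: (eqVneq h g) => [->|_]; rewrite ?addr0 ?subr0.
Qed.

(** * Stability of the Aztec diamond *)

Lemma aztecE_truncated (f0 f : face) (n : nat) :
  aztec f0 n f = if f == f0 then n%:Z else (n.+1 - dist f0 f)%N%:Z.
Proof. by rewrite aztecE; case: eqP => // _; lia. Qed.

Lemma aztec_marked (f0 : face) (n : nat) : aztec f0 n f0 = n%:Z.
Proof. by rewrite aztecE eqxx. Qed.

(** Adjacent unmarked faces differ by at most 1 in weight, and the neighbours of [f0] hold exactly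
    [n]. *)
Lemma aztec_stable (f0 : face) (n : nat) : stable f0 (aztec f0 n).
Proof.
move=> L; move eqK : (aztec f0 n) => K fireK.
case: fireK eqK => [f g adj_fg ne_f ne_g can|g adj_g can|g adj_g can] eqK;
  move: can; rewrite -eqK.
- have := adjacent_dist f0 adj_fg; move: (ne_f) (ne_g).
  rewrite -!dist_gt0 !aztecE_truncated.
  by rewrite (negbTE ne_f) (negbTE ne_g); lia.
- move: adj_g; rewrite adjacentE => /eqP dist_g.
  have /negbTE ne_g : g != f0 by rewrite -dist_gt0 dist_g.
  by rewrite !aztecE_truncated eqxx ne_g dist_g; lia.
- move: adj_g; rewrite adjacentE => /eqP dist_g.
  have /negbTE ne_g : g != f0 by rewrite -dist_gt0 dist_g.
  by rewrite !aztecE_truncated eqxx ne_g dist_g; lia.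
Qed.

(** * Flow along the rays *)

(* What the Aztec diamond holds on a ray from distance [d] on, minus what the
   pulse holds there. *)
Definition ray_flow (n r d : nat) : int :=
  'C(n.+1 - d.-1, 2)%:Z - (n * (r - d.-1))%N%:Z.

Lemma ray_flow_ge0 (n r d : nat) : (r <= uphalf n)%N -> 0 <= ray_flow n r d.
Proof.
move=> le_r; rewrite /ray_flow; move: d.-1 => {d} e.
rewrite subr_ge0 lez_nat -(leq_pmul2l (isT : (0 < 2)%N)).
have [le_re|lt_er] := leqP r e; first by rewrite (eqP le_re) !muln0.
have := mul_bin_diag (n.+1 - e) 1; rewrite bin1 => <-.
have le_en : (e <= n)%N by lia.
have -> : (n.+1 - e).-1 = (n - e)%N by lia.
have le_2r : (2 * r <= n.+1)%N by lia.
have {lt_er} [s def_r] : exists s, r = (e + s)%N by exists (r - e)%N; lia.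
have {le_en} [m def_n] : exists m, n = (e + m)%N by exists (n - e)%N; lia.
have -> : (r - e = s)%N by lia.
have -> : (n - e = m)%N by lia.
have -> : (n.+1 - e = m.+1)%N by lia.
have le_s : (2 * s + e <= m.+1)%N by lia.
rewrite def_n.
(* By [le_s], [2 * (e + m) * s] is at most [(m + e) * (m + 1 - e)], that is,
   [m * (m + 1) - e * (e - 1)]; the case split shows that [e * (e - 1)] is nonnegative. *)
by case: e {def_r def_n le_2r} le_s => [|e]; nia.
Qed.

Lemma ray_flow_far (n r d : nat) : (n < d)%N -> ray_flow n r d <= 0.
Proof.
by move=> lt_nd; rewrite /ray_flow bin_small ?sub0r ?oppr_le0 //; lia.
Qed.

Lemma ray_flow_step (n r d : nat) : (0 < d)%N ->
  ray_flow n r d - ray_flow n r d.+1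
    = (n.+1 - d)%N%:Z - (if (d <= r)%N then n%:Z else 0).
Proof.
case: d => // d _; rewrite /ray_flow /= subSS.
have -> : (r - d = (r - d.+1) + (d < r))%N by lia.
rewrite mulnDr.
have [le_dn|lt_nd] := leqP d n; last first.
  by rewrite !bin_small; try lia; case: (d < r)%N; lia.
by rewrite subSn // binS bin1; case: (d < r)%N; lia.
Qed.

(** [w f] counts the firings into [f] along its ray, capped by least action; the last equation is
    conservation of weight. *)
Definition on_rays (f0 : face) (n r : nat) (K : config) : Prop :=
  (forall f, 0 <= K f <= n%:Z) /\
  exists2 w : face -> int,
    forall f, 0 <= w f <= ray_flow n r (dist f0 f) &
    forall f, K f = pulse f0 n r f + w f - w (outward f0 f).

Lemma on_rays_pulse (f0 : face) (n r : nat) :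
  (r <= uphalf n)%N -> on_rays f0 n r (pulse f0 n r).
Proof.
move=> le_r; split=> [f|]; first by rewrite pulseE; case: ifP; lia.
by exists (fun=> 0) => f; rewrite ?addr0 ?subr0 // lexx ray_flow_ge0.
Qed.

Lemma on_rays_marked (f0 : face) (n r : nat) (K : config) :
  on_rays f0 n r K -> K f0 = n%:Z.
Proof.
by case=> _ [w _ ->]; rewrite outward_id addrK pulseE distxx.
Qed.

(** Such a face starts empty, and the cap allows no inflow. *)
Lemma on_rays_far (f0 f : face) (n r : nat) (K : config) :
  (r <= n)%N -> on_rays f0 n r K -> (n < dist f0 f)%N -> K f = 0.
Proof.
move=> le_rn [K_bd [w w_bd def_K]] lt_nf.
have := def_K f; rewrite pulseE leqNgt (leq_ltn_trans le_rn lt_nf) /=.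
have := ray_flow_far r lt_nf.
by have := w_bd f; have := w_bd (outward f0 f); have := K_bd f; lia.
Qed.

(* Least action: if the edge from [f] to [outward f0 f] already carries its full
   [ray_flow], then [f] holds at most, and [outward f0 f] at least, its weight in
   the Aztec diamond; the two differ by at most 1, so no firing is possible. *)
Lemma on_rays_fire (f0 f : face) (n r : nat) (K : config) :
  on_rays f0 n r K -> f != f0 -> K f >= K (outward f0 f) + 2 ->
  on_rays f0 n r [fsfun K with f |-> K f - 1,
                               outward f0 f |-> K (outward f0 f) + 1].
Proof.
set g := outward f0 f => -[K_bd [w w_bd def_K]] ne_f can_fire.
have dist_g : dist f0 g = (dist f0 f).+1 by exact: dist_outward.
have ne_fg : f != g by apply/eqP => eq_fg; move: dist_g; rewrite -eq_fg; lia.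
have lt_flow : w g < ray_flow n r (dist f0 g).
  rewrite ltNge; apply/negP => le_flow.
  have := def_K f; have := def_K g; rewrite -/g !pulseE.
  have := w_bd f; have := w_bd (outward f0 g).
  rewrite dist_outward ?outward_neq //.
  have dist_f : (0 < dist f0 f)%N by rewrite dist_gt0.
  have := ray_flow_step n r dist_f.
  have := ray_flow_step n r (ltn0Sn (dist f0 f)).
  rewrite -/g !dist_g; rewrite dist_g in le_flow.
  by move: can_fire le_flow; do 2 case: ifP => _; lia.
split=> [h|].
  rewrite fired_weight //; have := K_bd f; have := K_bd g; have := K_bd h.
  case: (eqVneq h g) => [->|_]; first by rewrite eq_sym (negbTE ne_fg); lia.
  by case: (eqVneq h f) => [->|_]; lia.
exists (fun h => w h + (h == g)%:Z) => h.
  by have := w_bd h; case: (eqVneq h g) => [->|_]; lia.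
by rewrite fired_weight // def_K (inj_eq (@outward_inj f0)); lia.
Qed.

(** * From the pulse to below the diamond, then up to it *)

Definition below_aztec (f0 : face) (n : nat) (K : config) : Prop :=
  K f0 = n%:Z /\ forall f, 0 <= K f <= aztec f0 n f.

Lemma pulse_reaches_below_aztec (f0 : face) (n r : nat) :
  (r <= uphalf n)%N ->
  exists2 K, clos_refl_trans_1n config (fire f0) (pulse f0 n r) K
           & below_aztec f0 n K.
Proof.
move=> le_r; have le_rn : (r <= n)%N by lia.
(* A face at distance [n] fires towards distance [n.+1], so the moment must cover that distance
   too. *)
apply: (progress_reaches (m := moment (box f0 n.+1) f0) (P := on_rays f0 n r)).
- by move=> K [K_bd _]; apply: (@moment_le _ _ n%:Z) => f; case/andP: (K_bd f).
- move=> K inv; have [K_bd _] := inv.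
  have [/hasP[f _ /andP[ne_f can_fire]]|/hasPn stuck] := boolP
    (has (fun f => (f != f0) && (K (outward f0 f) + 2 <= K f)) (box f0 n)).
    have le_f : (dist f0 f <= n)%N.
      rewrite leqNgt; apply/negP => /(on_rays_far le_rn inv) K0.
      by have := K_bd (outward f0 f); lia.
    have dist_g := dist_outward ne_f.
    right; exists [fsfun K with f |-> K f - 1,
                               outward f0 f |-> K (outward f0 f) + 1].
      by apply: fire_unmarked; rewrite ?adjacent_outward ?outward_neq.
    split; first exact: on_rays_fire.
    rewrite moment_fire ?ltrDl ?mem_box //; try lia.
    by apply/eqP => eq_f; move: dist_g; rewrite -eq_f; lia.
  left; split; first exact: on_rays_marked inv.
  move=> f; have /andP[-> le_Kf] := K_bd f; rewrite aztecE_truncated /=.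
  case: eqVneq => // ne_f.
  (* Induction inwards along the ray from beyond distance [n], where the weights vanish: each step
     towards [f0] raises the weight by at most 1. *)
  have [k] := ubnP (n.+1 - dist f0 f)%N.
  elim: k => // k IHk in f ne_f le_Kf * => lt_k.
  have [le_f|lt_f] := leqP (dist f0 f) n; last first.
    by rewrite (on_rays_far le_rn inv lt_f).
  have := stuck f (mem_box le_f); rewrite ne_f /= -ltNge.
  have [_ le_Kg] := andP (K_bd (outward f0 f)).
  have := IHk _ (outward_neq ne_f) le_Kg; rewrite dist_outward //; lia.
- exact: on_rays_pulse.
Qed.

Lemma below_aztec_reaches (f0 : face) (n : nat) (K : config) :
  below_aztec f0 n K ->
  clos_refl_trans_1n config (fire f0) K (aztec f0 n).
Proof.
move=> below; suff [L K_L <-] : exists2 L,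
  clos_refl_trans_1n config (fire f0) K L & L = aztec f0 n by [].
apply: (progress_reaches (m := moment (box f0 n) f0) (P := below_aztec f0 n))
  below.
  move=> {}K [_ K_bd]; apply: (@moment_le _ _ n%:Z) => f.
  have /andP[_ /le_trans->//] := K_bd f.
  rewrite aztecE_truncated; case: eqVneq => // ne_f.
  by rewrite -dist_gt0 in ne_f; lia.
move=> {}K [K_f0 K_bd].
(* A face in deficit whose neighbours closer to [f0] are all full. *)
pose ready f := [&& f != f0, K f < aztec f0 n f &
  all (fun g => (adjacent g f && (dist f0 f == (dist f0 g).+1)) ==>
                (K g == aztec f0 n g)) (box f0 n)].
have [/hasP[f f_in /and3P[ne_f lt_Kf /allP full]]|/hasPn no_ready] :=
  boolP (has ready (box f0 n)).
  have [g adj_gf dist_f] := closer_neighbour ne_f.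
  have le_f : (dist f0 f <= n)%N.
    have /andP[ge0 _] := K_bd f.
    by move: lt_Kf; rewrite aztecE_truncated (negbTE ne_f); lia.
  have g_in : g \in box f0 n by apply: mem_box; lia.
  have := full g g_in; rewrite adj_gf dist_f eqxx => /eqP K_g.
  right; have [eq_g|ne_g] := eqVneq g f0.
    rewrite {}eq_g distxx in adj_gf dist_f g_in *.
    have lt_n : K f < n%:Z.
      by move: lt_Kf; rewrite aztecE_truncated (negbTE ne_f) dist_f; lia.
    exists [fsfun K with f |-> K f + 1].
      by apply: fire_from_marked; rewrite ?K_f0.
    split; last by rewrite moment_with // dist_f; lia.
    split; first by rewrite fsfun_withE eq_sym (negbTE ne_f).
    move=> h; rewrite fsfun_withE; case: eqP => [->|//].
    by have := K_bd f; lia.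
  (* The full face [g] holds one more than the target of [f], and [f] is below its target. *)
  have can_fire : K f + 2 <= K g.
    move: lt_Kf; rewrite K_g !aztecE_truncated (negbTE ne_f) (negbTE ne_g).
    by rewrite dist_f; lia.
  have ne_gf : g != f by apply/eqP => eq_g; move: dist_f; rewrite eq_g; lia.
  exists [fsfun K with g |-> K g - 1, f |-> K f + 1]; first exact: fire_unmarked.
  split; last by rewrite moment_fire // ltrDl.
  split.
    by rewrite fired_weight // !(eq_sym f0) (negbTE ne_f) (negbTE ne_g); lia.
  move=> h; rewrite fired_weight //.
  have := K_bd f; have := K_bd g; have := K_bd h.
  case: (eqVneq h f) => [->|_]; first by rewrite eq_sym (negbTE ne_gf); lia.
  by case: (eqVneq h g) => [->|_]; lia.
(* Induction on the distance: once all closer faces are full, a deficit at [f] would make it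
   ready. *)
left; apply/fsfunP => f; have [k] := ubnP (dist f0 f).
elim: k => // k IHk in f * => lt_k.
have [->|ne_f] := eqVneq f f0; first by rewrite aztec_marked.
have := K_bd f; have [le_f|lt_f] := leqP (dist f0 f) n; last first.
  by rewrite aztecE_truncated (negbTE ne_f); lia.
have := no_ready f (mem_box le_f); rewrite /ready ne_f /=.
have -> : all (fun g => (adjacent g f && (dist f0 f == (dist f0 g).+1)) ==>
                (K g == aztec f0 n g)) (box f0 n).
  by apply/allP => g _; apply/implyP => /andP[_ /eqP dist_f]; apply/eqP/IHk; lia.
by rewrite andbT -leNgt => ? /andP[_ ?]; apply/le_anti/andP.
Qed.

Unset Implicit Arguments.
Local Close Scope ring_scope.

Theorem theorem5p10 (f0 : face) (n r : nat) :
  2 <= r <= uphalf n -> can_terminate_in f0 (pulse f0 n r) (aztec f0 n).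
Proof.
case/andP=> _ le_r; split; last exact: aztec_stable.
have [K to_K below] := pulse_reaches_below_aztec f0 le_r.
exact: clos_rt1n_append to_K (below_aztec_reaches below).
Qed.
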